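(* Consider the infinite-horizon remote estimation problem with a first-order autoregressive source described in the context, under the bounded-distortion assumption stated there. The infinite-horizon value function $J_\beta$ and transmission strategy $\tilde f_\beta$ satisfy: (1) For all $s\in\mathbb S$, $J_\beta(e,s)$ is even and quasi-convex in $e$. Furthermore, if $Q$ is stochastically monotone, i.e., with $\mathbb S=\{1,\dots,n\}$, for all $i>j$ and any $\ell\in\{0,\dots,n-1\}$, $\sum_{k=\ell+1}^nQ_{ik}\ge\sum_{k=\ell+1}^nQ_{jk}$, then: (2) For every $e\in\mathbb X$, $J_\beta(e,s)$ is decreasing in $s$. (3) For every $s\in\mathbb S$, the transmission strategy $\tilde f_\beta(e,s)$ is even and quasi-convex in $e$.
   Context: $\mathbb X$ is $\mathbb Z$ or $\mathbb R$; $a\in\mathbb X$; $\{W_t\}$ i.i.d. $\mathbb X$-valued with symmetric and unimodal distribution $\mu$ (pdf if $\mathbb X=\mathbb R$, pmf if $\mathbb X=\mathbb Z$). $\mathbb S=\{1,\dots,n\}$ is the ordered set of channel states (larger = better) with transition matrix $Q$. $\mathbb U\subset\mathbb R_{\ge0}$ is a finite set $\{0,u_{(1)},\dots,u_{\max}\}$ or the interval $[0,u_{\max}]$. The packet-drop probability $p(s,u)$ is weakly decreasing in $u$ and decreasing in $s$, with $p(s,0)=1$. The transmission cost $\lambda$ is weakly increasing, $\lambda(0)=0$, $\lambda(u_{\max})<\infty$; the distortion $d$ is even and quasi-convex, $d(0)=0$. ''Decreasing'' is meant in the weak sense. Error dynamics: given $E_t=e$, $S_{t-1}=s$, $U_t=u$,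 $S_t=s'$ with probability $Q_{ss'}$; then $E_{t+1}=ae+W_t$ with probability $p(s',u)$ (packet dropped) and $E_{t+1}=W_t$ with probability $1-p(s',u)$ (packet received). For $\beta\in(0,1)$, $J_\beta$ is the smallest bounded solution of $$J_\beta(e,s)=\min_{u\in\mathbb U}\Big\{(1-\beta)\Big[\lambda(u)+\sum_{s'\in\mathbb S}Q_{ss'}p(s',u)d(e)\Big]+\beta\,\mathbb E[J_\beta(E_{t+1},S_t)\mid E_t=e,S_{t-1}=s,U_t=u]\Big\},$$ and $\tilde f_\beta(e,s)$ is the arg min of the right-hand side, which is an optimal time-homogeneous transmission strategy $U_t=\tilde f_\beta(E_t,S_{t-1})$ for the discounted problem; for $\beta=1$ (long-run average cost), $\tilde f_1$ is a limit point of $\{\tilde f_\beta\}_{\beta\in(0,1)}$ as $\beta\uparrow1$, which is optimal. Bounded-distortion assumption: for the given $\beta\in(0,1]$, under the strategy that always transmits at power $u_{\max}$, for all $e\in\mathbb X$ and $s\in\mathbb S$ the expected distortion is finite, where the expected distortion is $(1-\beta)\mathbb E[\sum_{t=0}^\infty\beta^td(E_t)\mid E_0=e,S_{-1}=s]$ for $\beta\in(0,1)$ and $\lim_{T\to\infty}\frac1T\mathbb E[\sum_{t=0}^{T-1}d(E_t)\mid E_0=e,S_0=s]$ for $\beta=1$.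
   Formalization: Where the arg min is not unique, the strategy is taken to be the least minimizer everywhere or the greatest minimizer everywhere; for arbitrary selections claim (3) fails (e.g. zero transmission cost and zero distortion). *)

(* Defs.v *)
(* MathComp-Analysis world. *)
From HB Require Import structures.
From mathcomp Require Import all_boot all_order all_algebra.
From mathcomp Require Import all_classical all_reals all_analysis.

Set Implicit Arguments.
Unset Strict Implicit.
Unset Printing Implicit Defensive.

Import Order.TTheory GRing.Theory Num.Theory.
Import numFieldNormedType.Exports.

Local Open Scope classical_set_scope.
Local Open Scope ring_scope.

Inductive alphabet := Integers | Reals.

Definition carrier (R : realType) (t : alphabet) : realDomainType :=
  match t with Integers => int | Reals => R end.

Definition even_fun (X : realDomainType) (R : realDomainType) (g : X -> R) :=
  forall x, g (- x) = g x.

(* Order-theoretic, so that it makes sense on int as well as on R; on R, the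
   points between x and y are exactly their convex combinations. *)
Definition quasi_convex (X : realDomainType) (R : realDomainType)
    (g : X -> R) :=
  forall x z y, x <= z -> z <= y -> g z <= Num.max (g x) (g y).

Definition unimodal (X : realDomainType) (R : realDomainType) (g : X -> R) :=
  exists m, (forall x y, x <= y -> y <= m -> g x <= g y) /\
            (forall x y, m <= x -> x <= y -> g y <= g x).

Definition measurable_src (R : realType) (t : alphabet) :
    (carrier R t -> R) -> Prop :=
  match t return (carrier R t -> R) -> Prop with
  | Integers => fun _ => True
  | Reals => fun g : R -> R => measurable_fun setT g
  end.

(* Expectation of g(W), g >= 0, for W with pmf (on int) or pdf (on R) mu. *)
Definition expect (R : realType) (t : alphabet) :
    (carrier R t -> R) -> (carrier R t -> \bar R) -> \bar R :=
  match t return (carrier R t -> R) -> (carrier R t -> \bar R) -> \bar R with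
  | Integers => fun (mu : int -> R) (g : int -> \bar R) =>
      (\esum_(w in [set: int]) ((mu w)%:E * g w))%E
  | Reals => fun (mu : R -> R) (g : R -> \bar R) =>
      (\int[lebesgue_measure]_w ((mu w)%:E * g w))%E
  end.

(* State i : 'I_nstates stands for the channel state i + 1. *)
Record model (R : realType) (t : alphabet) := Model {
  nstates : nat;
  ar_coef : carrier R t;
  noise : carrier R t -> R;
  chan : 'M[R]_nstates;
  powers : set R;
  umax : R;
  drop_prob : 'I_nstates -> R -> R;
  tx_cost : R -> R;
  distortion : carrier R t -> R
}.
Arguments drop_prob {R t} m s u.

Definition symmetric_unimodal_distribution (R : realType) (t : alphabet)
    (mu : carrier R t -> R) :=
  [/\ forall w, 0 <= mu w, measurable_src mu, expect mu (fun=> 1%E) = 1%E,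
      even_fun mu & unimodal mu].

Definition stochastic_matrix (R : realType) (n : nat) (Q : 'M[R]_n) :=
  (forall i j, 0 <= Q i j) /\ (forall i, \sum_j Q i j = 1).

Definition stochastically_monotone (R : realType) (n : nat) (Q : 'M[R]_n) :=
  forall i j : 'I_n, (j < i)%N -> forall l : nat, (l < n)%N ->
    \sum_(k < n | (l <= k)%N) Q j k <= \sum_(k < n | (l <= k)%N) Q i k.

Definition power_set (R : realType) (U : set R) (um : R) :=
  [/\ U 0, U um & forall u, U u -> 0 <= u <= um] /\
  (finite_set U \/ U = [set` `[0, um]]).

(* Finiteness of the cost at umax is built into tx_cost being real-valued. *)
Definition standing_assumptions (R : realType) (t : alphabet)
    (M : model R t) : Prop :=
  [/\ (0 < nstates M)%N,
      symmetric_unimodal_distribution (noise M),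
      stochastic_matrix (chan M) &
      power_set (powers M) (umax M)] /\
  [/\ forall s u, powers M u -> 0 <= drop_prob M s u <= 1,
      forall s, drop_prob M s 0 = 1,
      forall s u v, powers M u -> powers M v -> u <= v ->
        drop_prob M s v <= drop_prob M s u &
      forall (s s' : 'I_(nstates M)) u, powers M u -> (s <= s')%N ->
        drop_prob M s' u <= drop_prob M s u] /\
  [/\ tx_cost M 0 = 0 &
      forall u v, powers M u -> powers M v -> u <= v ->
        tx_cost M u <= tx_cost M v] /\
  [/\ even_fun (distortion M), quasi_convex (distortion M) &
      distortion M 0 = 0].

(* E[g(E_{t+1}, S_t) | E_t = e, S_t = s', U_t = u], for g >= 0. *)
Definition packet_step (R : realType) (t : alphabet) (M : model R t) (u : R)
    (g : carrier R t -> 'I_(nstates M) -> \bar R)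
    (e : carrier R t) (s' : 'I_(nstates M)) : \bar R :=
  ((drop_prob M s' u)%:E *
     expect (noise M) (fun w => g (ar_coef M * e + w)%R s') +
   (1 - drop_prob M s' u)%:E * expect (noise M) (fun w => g w s'))%E.

(* E[g(E_{t+1}, S_t) | E_t = e, S_{t-1} = s, U_t = u], for g >= 0. *)
Definition transition (R : realType) (t : alphabet) (M : model R t) (u : R)
    (g : carrier R t -> 'I_(nstates M) -> \bar R)
    (e : carrier R t) (s : 'I_(nstates M)) : \bar R :=
  (\sum_(s' < nstates M) (chan M s s')%:E * packet_step u g e s')%E.

(* E[d(E_k) | E_0 = e, S_{-1} = s] when always transmitting at power umax:
   the k-step operator of the Markov chain (E_t, S_{t-1}) applied to d. *)
Definition exp_distortion (R : realType) (t : alphabet) (M : model R t)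
    (k : nat) : carrier R t -> 'I_(nstates M) -> \bar R :=
  iter k (transition (umax M)) (fun e _ => (distortion M e)%:E).

(* E[d(E_k) | E_0 = e, S_0 = s] when always transmitting at power umax: here
   the first step is taken in the known channel state s. *)
Definition exp_distortion0 (R : realType) (t : alphabet) (M : model R t)
    (k : nat) (e : carrier R t) (s : 'I_(nstates M)) : \bar R :=
  match k with
  | 0%N => (distortion M e)%:E
  | k'.+1 => packet_step (umax M) (@exp_distortion R t M k') e s
  end.

Definition bounded_discounted_distortion (R : realType) (t : alphabet)
    (M : model R t) (b : R) :=
  forall e s, ((1 - b)%:E *
    (\sum_(0 <= k <oo) (b ^+ k)%:E * @exp_distortion R t M k e s) < +oo)%E.

Definition bounded_average_distortion (R : realType) (t : alphabet)
    (M : model R t) :=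
  forall e s, exists l : R,
    (fun T : nat => (T%:R^-1)%:E *
      \sum_(0 <= k < T) @exp_distortion0 R t M k e s)%E @ \oo --> l%:E.

Definition bellman_rhs (R : realType) (t : alphabet) (M : model R t) (b : R)
    (J : carrier R t -> 'I_(nstates M) -> R)
    (e : carrier R t) (s : 'I_(nstates M)) (u : R) : \bar R :=
  (((1 - b) * (tx_cost M u +
      \sum_(s' < nstates M) chan M s s' * drop_prob M s' u * distortion M e))%:E
   + b%:E * transition u (fun e' s' => (J e' s')%:E) e s)%E.

(* The distortion may be unbounded, in which case no solution is bounded
   uniformly in e: a solution is required to be finite at every (e, s), and
   nonnegative like the costs, and the value function is the least one. A
   uniformly bounded solution, if there is one, is that least solution. *)
Definition bellman_solution (R : realType) (t : alphabet) (M : model R t)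
    (b : R) (J : carrier R t -> 'I_(nstates M) -> R) :=
  [/\ forall e s, 0 <= J e s,
      forall s, measurable_src (fun e => J e s) &
      forall e s, (J e s)%:E = ereal_inf (bellman_rhs b J e s @` powers M)].

Definition is_value_function (R : realType) (t : alphabet) (M : model R t)
    (b : R) (J : carrier R t -> 'I_(nstates M) -> R) :=
  bellman_solution b J /\
  forall J', bellman_solution b J' -> forall e s, J e s <= J' e s.

Definition minimizers (R : realType) (t : alphabet) (M : model R t) (b : R)
    (J : carrier R t -> 'I_(nstates M) -> R)
    (e : carrier R t) (s : 'I_(nstates M)) : set R :=
  [set u | powers M u /\
     forall v, powers M v -> (bellman_rhs b J e s u <= bellman_rhs b J e s v)%E].

(* Ties are broken consistently, by the least minimizer everywhere or by the
   greatest one everywhere: an arbitrary selection of minimizers need not be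
   even (take tx_cost = 0 and drop_prob = 1). If the minimizers are unique,
   there is nothing to choose. *)
Definition is_argmin_strategy (R : realType) (t : alphabet) (M : model R t)
    (b : R) (J : carrier R t -> 'I_(nstates M) -> R)
    (f : carrier R t -> 'I_(nstates M) -> R) :=
  (forall e s, minimizers b J e s (f e s)) /\
  ((forall e s, lbound (minimizers b J e s) (f e s)) \/
   (forall e s, ubound (minimizers b J e s) (f e s))).

(* Cluster point, as b tends to 1 from the left, for pointwise convergence;
   in particular any pointwise limit along a sequence b_k -> 1, b_k < 1. *)
Definition is_limit_point (R : realType) (t : alphabet) (n : nat)
    (f : R -> carrier R t -> 'I_n -> R) (f1 : carrier R t -> 'I_n -> R) :=
  cluster ((f : R -> {ptws carrier R t -> {ptws 'I_n -> R}}) @ 1^'-)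
    (f1 : {ptws carrier R t -> {ptws 'I_n -> R}}).

(* Main.v *)
(* If g is even and quasi-convex and W is symmetric and unimodal, reflecting
   about (x + y) / 2 shows that E[g(x + W)] is again even and quasi-convex in x.
   Hence the Bellman operator preserves monotonicity in |e|, and, when Q is
   stochastically monotone, also antitonicity in s. The supremum of the
   subsolutions below J with these monotonicity properties is a fixed point,
   so by minimality it is J. The one-step cost has decreasing differences in
   (|e|, u), so its extremal minimizers increase with |e|; this passes to
   pointwise cluster points as the discount factor tends to 1. *)

Require Import Defs.
From HB Require Import structures.
From mathcomp Require Import all_boot all_order all_algebra.
From mathcomp Require Import all_classical all_reals all_analysis.
From mathcomp Require Import measurable_realfun ring lra.

Set Implicit Arguments.
Unset Strict Implicit.
Unset Printing Implicit Defensive.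

Import Order.TTheory GRing.Theory Num.Theory.
Import numFieldNormedType.Exports.

Local Open Scope classical_set_scope.
Local Open Scope ring_scope.

(** * Lebesgue integrals under translation and reflection *)

(** Lebesgue measure is determined by its values on half-open intervals, so the pushforward by [phi]
    is Lebesgue measure again and a change of variables concludes. *)
Lemma ge0_integral_measure_preserving (R : realType) (phi : R -> R)
    (F : R -> \bar R) :
  measurable_fun setT phi ->
  (forall a b, lebesgue_measure (phi @^-1` `]a, b]) =
               lebesgue_measure (`]a, b]%classic : set R)) ->
  measurable_fun setT F -> (forall x, 0 <= F x)%E ->
  (\int[lebesgue_measure]_x F (phi x) = \int[lebesgue_measure]_x F x)%E.
Proof.
move=> mphi phiE mF F0.
have mphi' : @measurable_fun _ _ (measurableTypeR R) (measurableTypeR R) setT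
  phi by exact: mphi.
have mF' : @measurable_fun _ _ (measurableTypeR R) _ setT F by exact: mF.
pose mphi_mixin := isMeasurableFun.Build _ _ _ _ _ mphi'.
pose psi : {mfun measurableTypeR R >-> measurableTypeR R} :=
  HB.pack phi mphi_mixin.
have pushE A : measurable A ->
    pushforward lebesgue_measure psi A = lebesgue_measure A.
  move=> mA; apply/esym/lebesgue_measure_unique => // _ [[a b]] _ <-.
  exact: esym (phiE a b).
have := @ge0_integral_pushforward _ _ _ _ R psi mphi' lebesgue_measure setT F
  measurableT mF'.
rewrite preimage_setT => <- //.
by apply: eq_measure_integral => A mA _; exact: pushE.
Qed.

Lemma ge0_integral_translate (R : realType) (c : R) (F : R -> \bar R) :
  measurable_fun setT F -> (forall x, 0 <= F x)%E ->
  (\int[lebesgue_measure]_x F (c + x)%R = \int[lebesgue_measure]_x F x)%E.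
Proof.
apply: (@ge0_integral_measure_preserving R (fun x => c + x)).
  by apply: measurable_funD; [exact: measurable_cst|exact: measurable_id].
move=> a b.
rewrite [X in lebesgue_measure X = _](_ : _ = `]a - c, b - c]%classic).
  rewrite !lebesgue_measure_itv/= !lte_fin ltrD2r.
  by case: ifP => // _; congr (_%:E); lra.
by apply/seteqP; split=> x /=; rewrite !in_itv/= ltrBlDl lerBrDl.
Qed.

Lemma ge0_integral_reflect (R : realType) (c : R) (F : R -> \bar R) :
  measurable_fun setT F -> (forall x, 0 <= F x)%E ->
  (\int[lebesgue_measure]_x F (c - x)%R = \int[lebesgue_measure]_x F x)%E.
Proof.
apply: (@ge0_integral_measure_preserving R (fun x => c - x)).
  by apply: measurable_funB; [exact: measurable_cst|exact: measurable_id].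
move=> a b.
(* The reflection exchanges the open and the closed end point; the length is unaffected. *)
rewrite [X in lebesgue_measure X = _](_ : _ = `[c - b, c - a[%classic).
  rewrite !lebesgue_measure_itv/= !lte_fin ltrD2l ltrN2.
  by case: ifP => // _; congr (_%:E); lra.
by apply/seteqP; split=> x /=; rewrite !in_itv/= => /andP[? ?];
  apply/andP; split; lra.
Qed.

(** * Monotonicity in the absolute value *)

(** Stands in for evenness together with quasi-convexity. Values in any partial order are allowed,
    so that it also applies to extended-real costs. *)
Definition norm_homo (X : realDomainType) (disp : Order.disp_t)
    (Y : porderType disp) (g : X -> Y) :=
  forall x y, `|x| <= `|y| -> (g x <= g y)%O.

(** A point between [x] and [y] is no larger in absolute value than [y] if it is nonnegative, and
    than [x] otherwise. Conversely, [|x|] lies in the interval from [- |y|] to [|y|], and evenness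
    gives both its end points the value [g y]. *)
Lemma norm_homoP (X R : realDomainType) (g : X -> R) :
  norm_homo g <-> even_fun g /\ quasi_convex g.
Proof.
split=> [gh | [ge gq] x y xy].
- split=> [x | x z y xz zy].
    by apply/le_anti; rewrite !gh // normrN.
  rewrite le_max; have [z0|z0] := leP 0 z.
    by rewrite [X in _ || X]gh ?orbT // !ger0_norm // (le_trans z0).
  by rewrite gh // !ltr0_norm ?lerN2 // (le_lt_trans xz).
have normE z : g `|z| = g z.
  by case: (ler0P z) => // _; rewrite ge.
rewrite -normE -[leRHS]normE.
have := gq (- `|y|) `|x| `|y|; rewrite ge maxxx; apply=> //.
by apply: le_trans (normr_ge0 x); rewrite oppr_le0.
Qed.

(** The mode [m] need not be 0. If [m <= 0], the decreasing branch covers the nonnegative half-line;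
    otherwise the increasing branch covers the nonpositive one, and evenness transfers the
    inequality. *)
Lemma norm_antitone_unimodal (X R : realDomainType) (mu : X -> R) :
  even_fun mu -> unimodal mu -> forall x y, `|x| <= `|y| -> mu y <= mu x.
Proof.
move=> mue [m [mul mur]] x y xy.
have normE z : mu `|z| = mu z.
  by case: (ler0P z) => // _; rewrite mue.
rewrite -normE -[leRHS]normE; have [m0|m0] := leP m 0.
  by apply: mur => //; exact: le_trans m0 _.
rewrite -mue -[leRHS]mue; apply: mul; first by rewrite lerN2.
by apply: le_trans (ltW m0); rewrite oppr_le0.
Qed.

(** On the reals, [g] factors through the absolute value followed by the nondecreasing function
    [g \o Num.max 0], and monotone functions are measurable. *)
Lemma measurable_src_norm_homo (R : realType) (t : alphabet)
    (g : carrier R t -> R) : norm_homo g -> measurable_src g.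
Proof.
case: t g => //= g gh.
have gE : g = (g \o Num.max 0) \o (@Num.norm _ R).
  apply/funext=> x /=; rewrite max_r //.
  by apply/le_anti; rewrite !gh // normr_id.
rewrite gE; apply: measurableT_comp; last exact: normr_measurable.
apply: nondecreasing_measurable => // x y xy /=.
by apply: gh; rewrite !ger0_norm ?le_max2 // le_max lexx.
Qed.

(** * Measurability and integration on both alphabets *)

Lemma measurable_srcM (R : realType) (t : alphabet) (f g : carrier R t -> R) :
  measurable_src f -> measurable_src g -> measurable_src (fun x => f x * g x).
Proof. by case: t f g => //= f g; exact: measurable_funM. Qed.

Lemma measurable_srcD (R : realType) (t : alphabet) (f g : carrier R t -> R) :
  measurable_src f -> measurable_src g -> measurable_src (fun x => f x + g x).
Proof. by case: t f g => //= f g; exact: measurable_funD. Qed.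

Lemma measurable_src_translate (R : realType) (t : alphabet)
    (f : carrier R t -> R) (c : carrier R t) :
  measurable_src f -> measurable_src (fun x => f (c + x)).
Proof.
case: t f c => //= f c mf; apply: measurableT_comp => //.
by apply: measurable_funD; [exact: measurable_cst|exact: measurable_id].
Qed.

Lemma measurable_src_reflect (R : realType) (t : alphabet)
    (f : carrier R t -> R) (c : carrier R t) :
  measurable_src f -> measurable_src (fun x => f (c - x)).
Proof.
case: t f c => //= f c mf; apply: measurableT_comp => //.
by apply: measurable_funB; [exact: measurable_cst|exact: measurable_id].
Qed.

Definition src_integral (R : realType) (t : alphabet) :
    (carrier R t -> \bar R) -> \bar R :=
  match t return (carrier R t -> \bar R) -> \bar R with
  | Integers => fun F : int -> \bar R => (\esum_(w in [set: int]) F w)%E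
  | Reals => fun F : R -> \bar R => (\int[lebesgue_measure]_w F w)%E
  end.

Lemma expectE (R : realType) (t : alphabet) (mu g : carrier R t -> R) :
  expect mu (fun w => (g w)%:E) = src_integral (fun w => (mu w * g w)%:E).
Proof.
case: t mu g => /= mu g.
  by apply: eq_esum => w _; rewrite EFinM.
by apply: eq_integral => w _; rewrite EFinM.
Qed.

Lemma src_integral_ge0 (R : realType) (t : alphabet) (F : carrier R t -> R) :
  (forall x, 0 <= F x) -> (0 <= src_integral (fun w => (F w)%:E))%E.
Proof.
case: t F => /= F F0; first by apply: esum_ge0 => x _; rewrite lee_fin.
by apply: integral_ge0 => x _; rewrite lee_fin.
Qed.

Lemma le_src_integral (R : realType) (t : alphabet) (F G : carrier R t -> R) :
  measurable_src F -> measurable_src G ->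
  (forall x, 0 <= F x) -> (forall x, F x <= G x) ->
  (src_integral (fun w => (F w)%:E) <= src_integral (fun w => (G w)%:E))%E.
Proof.
case: t F G => /= F G mF mG F0 FG.
  by apply: le_esum => x _; rewrite lee_fin.
apply: ge0_le_integral => //; try by move=> x _; rewrite lee_fin.
- exact/measurable_EFinP.
- exact/measurable_EFinP.
Qed.

Lemma src_integralD (R : realType) (t : alphabet) (F G : carrier R t -> R) :
  measurable_src F -> measurable_src G ->
  (forall x, 0 <= F x) -> (forall x, 0 <= G x) ->
  src_integral (fun w => (F w + G w)%:E) =
  (src_integral (fun w => (F w)%:E) + src_integral (fun w => (G w)%:E))%E.
Proof.
case: t F G => /= F G mF mG F0 G0.
  by rewrite -esumD // => x _; rewrite lee_fin.
rewrite -ge0_integralD //; try by move=> x _; rewrite lee_fin.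
- exact/measurable_EFinP.
- exact/measurable_EFinP.
Qed.

Lemma src_integral_translate (R : realType) (t : alphabet)
    (F : carrier R t -> R) (c : carrier R t) :
  measurable_src F -> (forall x, 0 <= F x) ->
  src_integral (fun w => (F (c + w))%:E) = src_integral (fun w => (F w)%:E).
Proof.
case: t F c => /= F c mF F0.
  apply/esym; apply: (@reindex_esum R _ _ _ _ (fun w => c + w)
    (fun w => (F w)%:E)); split=> [//|x y _ _ /addrI//|y _].
  by exists (y - c) => //; rewrite addrC subrK.
have := @ge0_integral_translate R c (EFin \o F); apply.
  exact/measurable_EFinP.
by move=> x; rewrite lee_fin.
Qed.

Lemma src_integral_reflect (R : realType) (t : alphabet) (F : carrier R t -> R)
    (c : carrier R t) : measurable_src F -> (forall x, 0 <= F x) ->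
  src_integral (fun w => (F (c - w))%:E) = src_integral (fun w => (F w)%:E).
Proof.
case: t F c => /= F c mF F0.
  apply/esym; apply: (@reindex_esum R _ _ _ _ (fun w => c - w)
    (fun w => (F w)%:E)); split=> [//|x y _ _ /addrI /oppr_inj//|y _].
  by exists (c - y) => //; rewrite opprB addrC subrK.
have := @ge0_integral_reflect R c (EFin \o F); apply.
  exact/measurable_EFinP.
by move=> x; rewrite lee_fin.
Qed.

(** * Averaging over symmetric unimodal noise *)

(** For [v] to the right of the nonnegative midpoint of [x] and [y], reflection about that midpoint
    brings [v] no farther from 0, and [v] is nearer to [y] than to [x]. These comparisons order the
    values of [g] and of [mu] for the rearrangement inequality. *)
Lemma reflect_closer (X : realDomainType) (x y v : X) :
  x <= y -> 0 <= x + y -> x + y <= v + v ->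
  `|x + y - v| <= `|v| /\ `|v - y| <= `|v - x|.
Proof.
move=> xy s0 sv; have v0 : 0 <= v by lra.
have xv : 0 <= v - x by lra.
by rewrite (ger0_norm v0) (ger0_norm xv) !ler_norml; split;
  apply/andP; split; lra.
Qed.

(** The difference of the two sides is [(b - a) * (d - c)]. *)
Lemma ler_rearrange (R : realDomainType) (a b c d : R) :
  a <= b -> c <= d -> a * d + b * c <= a * c + b * d.
Proof. by move=> ab cd; nra. Qed.

(* Adding to each integral its image under the reflection v |-> x + y - v,
   which swaps x and y, reduces the comparison to the rearrangement
   inequality at every point v. *)
Lemma expect_norm_homo (R : realType) (t : alphabet) (mu g : carrier R t -> R) :
  measurable_src mu -> (forall w, 0 <= mu w) ->
  (forall x y, `|x| <= `|y| -> mu y <= mu x) ->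
  (forall x, 0 <= g x) -> norm_homo g ->
  norm_homo (fun x => expect mu (fun w => (g (x + w))%:E)).
Proof.
move=> mmu mu0 muh g0 gh; set h := fun x => _.
have gm := measurable_src_norm_homo gh.
have geven x : g (- x) = g x by apply/le_anti; rewrite !gh ?normrN.
have mueven x : mu (- x) = mu x by apply/le_anti; rewrite !muh ?normrN.
have F0 x : forall v, 0 <= mu (- x + v) * g v by move=> v; rewrite mulr_ge0.
have mF x : measurable_src (fun v => mu (- x + v) * g v).
  by apply: measurable_srcM => //; exact: measurable_src_translate.
(* The substitution [v = x + w] moves the shift from [g] to the density, so that only the weight of
   [g v] depends on [x]. *)
have hE x : h x = src_integral (fun v => (mu (- x + v) * g v)%:E).
  rewrite /h expectE.
  rewrite -(@src_integral_translate _ _ (fun v => mu (- x + v) * g v) x) //.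
  by congr src_integral; apply/funext => v; rewrite addKr.
have heven x : h (- x) = h x.
  rewrite /h !expectE -[RHS](@src_integral_reflect _ _
    (fun w => mu w * g (x + w)) 0).
  - congr src_integral; apply/funext => w.
    by rewrite sub0r mueven -[in RHS]geven opprB addrC.
  - by apply: measurable_srcM => //; exact: measurable_src_translate.
  - by move=> w; rewrite mulr_ge0.
have hnorm x : h `|x| = h x by case: (ler0P x).
suff hle (x y : carrier R t) : 0 <= x -> x <= y -> (h x <= h y)%E.
  by move=> x y xy; rewrite -hnorm -[leRHS]hnorm; apply: hle.
move=> x0 xy.
have dbl z : (h z + h z)%E = src_integral (fun v =>
    (mu (- z + v) * g v + mu (- z + (x + y - v)) * g (x + y - v))%:E).
  rewrite src_integralD // -?hE.
  - by rewrite (@src_integral_reflect _ _ (fun v => mu (- z + v) * g v)) // -hE.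
  - exact: (@measurable_src_reflect _ _ (fun v => mu (- z + v) * g v)).
(* Doubling reflects the order even with infinite values, because strict inequalities add. *)
suff hh : (h x + h x <= h y + h y)%E.
  by rewrite leNgt; apply/negP => hlt; have := lteD hlt hlt; rewrite ltNge hh.
have mFr z : measurable_src (fun v => mu (- z + (x + y - v)) * g (x + y - v)).
  exact: (@measurable_src_reflect _ _ (fun v => mu (- z + v) * g v)).
rewrite !dbl; apply: le_src_integral.
- exact: measurable_srcD.
- exact: measurable_srcD.
- by move=> v; rewrite addr_ge0 ?mulr_ge0.
move=> v.
have -> : mu (- x + (x + y - v)) = mu (- y + v).
  by rewrite -mueven; congr mu; ring.
have -> : mu (- y + (x + y - v)) = mu (- x + v).
  by rewrite -mueven; congr mu; ring.
have s0 : 0 <= x + y by lra.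
have [sv|vs] := leP (x + y) (v + v).
  have [n1 n2] := reflect_closer xy s0 sv.
  have := ler_rearrange (gh _ _ n1) (muh _ _ n2).
  by rewrite ![- _ + v]addrC; lra.
(* Left of the midpoint, the argument applies to the mirror image [x + y - v]: the pointwise
   inequality is invariant under exchanging it with [v]. *)
have sv : x + y <= (x + y - v) + (x + y - v) by lra.
have [n1 n2] := reflect_closer xy s0 sv.
have := ler_rearrange (gh _ _ n1) (muh _ _ n2).
rewrite (_ : x + y - (x + y - v) = v); last by ring.
have -> : mu (x + y - v - x) = mu (- y + v).
  by rewrite -mueven; congr mu; ring.
have -> : mu (x + y - v - y) = mu (- x + v).
  by rewrite -mueven; congr mu; ring.
by lra.
Qed.

(** * Expectations under a stochastically monotone matrix *)

(** Abel summation: [phi] is a nonnegative combination of indicators of initial segments, with its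
    successive decreases as coefficients. Peeling off the first state makes the induction work. *)
Lemma ge0_antitone_sum_tail (R : realType) (n : nat) (phi : 'I_n -> \bar R) :
  (forall k, 0 <= phi k)%E ->
  (forall k l : 'I_n, (k <= l)%N -> phi l <= phi k)%E ->
  exists2 c : 'I_n -> \bar R, (forall l, 0 <= c l)%E &
    forall k, phi k = (\sum_(l < n | (k <= l)%N) c l)%E.
Proof.
elim: n phi => [|n IH] phi phi0 phih.
  by exists (fun _ => 0%E) => // -[].
have [c c0 cE] := IH (phi \o lift ord0) (fun k => phi0 _)
  (fun k l kl => phih _ _ (kl : (lift ord0 k <= lift ord0 l)%N)).
have Tphi : (\sum_(l < n) c l <= phi ord0)%E.
  case: n phi phi0 phih c c0 cE {IH} => [|n] phi phi0 phih c c0 cE.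
    by rewrite big_ord0.
  have /= := cE ord0; under eq_bigl do rewrite leq0n.
  by move=> <-; apply: phih.
have T0 : (0 <= \sum_(l < n) c l)%E by apply: sume_ge0.
set T := (\sum_(l < n) c l)%E in Tphi T0.
(* If the tail sum is infinite, so is [phi ord0], and the coefficient 0 avoids subtracting
   infinities. *)
pose c1 : \bar R := if T == +oo%E then 0%E else (phi ord0 - T)%E.
have c1T : phi ord0 = (c1 + T)%E.
  rewrite /c1; case: eqP => [Too|/eqP Tfin].
    by rewrite add0e; apply/le_anti; rewrite Tphi Too leey.
  by rewrite subeK // ge0_fin_numE // ltey.
exists (fun l => if unlift ord0 l is Some l' then c l' else c1).
  move=> l; case: unliftP => [l' _|_] //.
  rewrite /c1; case: eqP => // /eqP Tfin.
  by rewrite sube_ge0 // [X in X || _]ge0_fin_numE // ltey Tfin.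
move=> k; case: (unliftP ord0 k) => [k' ->|->].
  rewrite big_mkcond big_ord_recl /= add0e.
  rewrite [LHS](cE k') big_mkcond; apply: eq_bigr => l _.
  by rewrite liftK.
rewrite big_ord_recl unlift_none c1T; congr (_ + _)%E.
by apply: eq_bigr => l _; rewrite liftK.
Qed.

(** The decomposition of [phi] turns each side into a nonnegative combination of probabilities of
    initial segments. These are complements of the upper tails that stochastic monotonicity
    compares. *)
Lemma stochastically_monotone_le (R : realType) (n : nat) (Q : 'M[R]_n)
    (phi : 'I_n -> \bar R) :
  stochastic_matrix Q -> stochastically_monotone Q ->
  (forall k, 0 <= phi k)%E ->
  (forall k l : 'I_n, (k <= l)%N -> phi l <= phi k)%E ->
  forall i j : 'I_n, (j <= i)%N ->
  (\sum_k (Q i k)%:E * phi k <= \sum_k (Q j k)%:E * phi k)%E.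
Proof.
move=> [Q0 Q1] Qm phi0 phih i j; rewrite leq_eqVlt => /orP[/eqP/val_inj->//|ji].
have [c c0 cE] := ge0_antitone_sum_tail phi0 phih.
have sumE m : (\sum_k (Q m k)%:E * phi k =
    \sum_(l < n) (\sum_(k < n | (k <= l)%N) Q m k)%:E * c l)%E.
  under eq_bigr => k _.
    rewrite cE ge0_sume_distrr // big_mkcond.
    over.
  rewrite exchange_big; apply: eq_bigr => l _ /=.
  by rewrite -big_mkcond -sumEFin ge0_sume_distrl // => k _; rewrite lee_fin.
rewrite !sumE; apply: lee_sum => l _; apply: lee_wpmul2r => //; rewrite lee_fin.
have headE m : \sum_(k < n | (k <= l)%N) Q m k =
    1 - \sum_(k < n | (l.+1 <= k)%N) Q m k.
  rewrite -(Q1 m) (bigID (fun k : 'I_n => (k <= l)%N) xpredT) /=.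
  by under [X in _ = _ + X - _]eq_bigl => k do rewrite -ltnNge; rewrite addrK.
rewrite !headE lerB //.
(* For the last [l] the upper tail is empty, a case outside the range of
   [stochastically_monotone]. *)
have [ln|nl] := ltnP l.+1 n; first exact: Qm.
by rewrite !big_pred0 // => k; apply/negbTE;
  rewrite -ltnNge; exact: leq_trans (ltn_ord k) nl.
Qed.

(** * Mixtures over packet loss and reception *)

(** The mass [p - q] moves from [y] to the larger [x]. Splitting weights instead of subtracting
    products keeps every term nonnegative, so infinite values are harmless. *)
Lemma le_mix (R : realType) (p q : R) (x y : \bar R) :
  0 <= q -> q <= p -> p <= 1 -> (0 <= y)%E -> (y <= x)%E ->
  (q%:E * x + (1 - q)%:E * y <= p%:E * x + (1 - p)%:E * y)%E.
Proof.
move=> q0 qp p1 y0 yx; have x0 := le_trans y0 yx.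
rewrite (_ : p = q + (p - q)); last by ring.
rewrite (_ : 1 - q = (p - q) + (1 - (q + (p - q)))); last by ring.
rewrite ![(_ + _)%:E]EFinD ge0_muleDl ?lee_fin ?subr_ge0//.
  rewrite [X in (_ <= X + _)%E]ge0_muleDl ?lee_fin ?subr_ge0 //.
  rewrite -addeA leeD2l // leeD2r // lee_wpmul2l // lee_fin subr_ge0 //.
by rewrite addrC subrK.
Qed.

(** For finite values the gap is [(p - q) * (x' - x)]: a growing drop cost weighs more where drops
    are likelier. This is the source of decreasing differences in error and power. *)
Lemma mix_submodular (R : realType) (p q : R) (x x' y : \bar R) :
  0 <= q -> q <= p -> p <= 1 -> (0 <= y)%E -> (0 <= x)%E -> (x <= x')%E ->
  ((p%:E * x + (1 - p)%:E * y) + (q%:E * x' + (1 - q)%:E * y) <=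
   (q%:E * x + (1 - q)%:E * y) + (p%:E * x' + (1 - p)%:E * y))%E.
Proof.
move=> q0 qp p1 y0 x0 xx'; have x'0 := le_trans x0 xx'.
rewrite addeACA [leRHS]addeACA [X in (_ <= _ + X)%E]addeC leeD2r //.
rewrite (_ : p = q + (p - q)); last by ring.
rewrite EFinD !ge0_muleDl ?lee_fin ?subr_ge0 //.
rewrite -addeA leeD2l // addeC leeD2l // lee_wpmul2l // lee_fin subr_ge0 //.
Qed.

(** * The Bellman right-hand side *)

(** Regrouping by the outcome of the transmission confines the error [e] to the drop branch and,
    apart from the transmission cost, the power [u] to the weights of the mixture. *)
Definition drop_cost (R : realType) (t : alphabet) (M : model R t) (b : R)
    (g : carrier R t -> 'I_(nstates M) -> R) (e : carrier R t)
    (s' : 'I_(nstates M)) : \bar R :=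
  (((1 - b) * distortion M e)%:E +
   b%:E * expect (noise M) (fun w => (g (ar_coef M * e + w)%R s')%:E))%E.

Definition recv_cost (R : realType) (t : alphabet) (M : model R t) (b : R)
    (g : carrier R t -> 'I_(nstates M) -> R) (s' : 'I_(nstates M)) : \bar R :=
  (b%:E * expect (noise M) (fun w => (g w s')%:E))%E.

Definition step_cost (R : realType) (t : alphabet) (M : model R t) (b : R)
    (g : carrier R t -> 'I_(nstates M) -> R) (u : R) (e : carrier R t)
    (s' : 'I_(nstates M)) : \bar R :=
  ((drop_prob M s' u)%:E * drop_cost b g e s' +
   (1 - drop_prob M s' u)%:E * recv_cost b g s')%E.

Lemma expect_ge0 (R : realType) (t : alphabet) (mu g : carrier R t -> R) :
  (forall w, 0 <= mu w) -> (forall w, 0 <= g w) ->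
  (0 <= expect mu (fun w => (g w)%:E))%E.
Proof.
by move=> mu0 g0; rewrite expectE src_integral_ge0 // => w; rewrite mulr_ge0.
Qed.

Lemma le_expect (R : realType) (t : alphabet) (mu g h : carrier R t -> R) :
  (forall w, 0 <= mu w) -> measurable_src mu ->
  measurable_src g -> measurable_src h ->
  (forall w, 0 <= g w) -> (forall w, g w <= h w) ->
  (expect mu (fun w => (g w)%:E) <= expect mu (fun w => (h w)%:E))%E.
Proof.
move=> mu0 mmu mg mh g0 gh; rewrite !expectE; apply: le_src_integral.
- exact: measurable_srcM.
- exact: measurable_srcM.
- by move=> w; rewrite mulr_ge0.
- by move=> w; rewrite ler_wpM2l.
Qed.

Section bellman_operator.
Context (R : realType) (t : alphabet) (M : model R t) (b : R).
Hypotheses (hM : standing_assumptions M) (b0 : 0 < b) (b1 : b < 1).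
Implicit Types (g : carrier R t -> 'I_(nstates M) -> R) (s : 'I_(nstates M)).

Let mu0 w : 0 <= noise M w. Proof. by have [[_ [] ]] := hM. Qed.

Let mmu : measurable_src (noise M). Proof. by have [[_ [] ]] := hM. Qed.

Let muh x y : `|x| <= `|y| -> noise M y <= noise M x.
Proof.
have [[_ [_ _ _ mue muu] _ _] _] := hM.
exact: norm_antitone_unimodal.
Qed.

Let Q0 s s' : 0 <= chan M s s'.
Proof. by have [[_ _ [] ]] := hM. Qed.

Let Q1 s : \sum_s' chan M s s' = 1.
Proof. by have [[_ _ [] ]] := hM. Qed.

Let dist_norm_homo : norm_homo (distortion M).
Proof. by have [_ [_ [_ [de dq _]]]] := hM; apply/norm_homoP. Qed.

Let dist0 e : 0 <= distortion M e.
Proof.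
have [_ [_ [_ [_ _ <-]]]] := hM.
by apply: dist_norm_homo; rewrite normr0.
Qed.

Let prob0 s u : powers M u -> 0 <= drop_prob M s u.
Proof. by have [_ [[p01 _ _ _] _]] := hM => /(p01 s)/andP[]. Qed.

Let prob1 s u : powers M u -> drop_prob M s u <= 1.
Proof. by have [_ [[p01 _ _ _] _]] := hM => /(p01 s)/andP[]. Qed.

Let prob_u s u v : powers M u -> powers M v -> u <= v ->
  drop_prob M s v <= drop_prob M s u.
Proof. by have [_ [[_ _ pu _] _]] := hM; exact: pu. Qed.

Let prob_s s s' u : powers M u -> (s <= s')%N ->
  drop_prob M s' u <= drop_prob M s u.
Proof. by have [_ [[_ _ _ ps] _]] := hM; exact: ps. Qed.

Let cost0 u : powers M u -> 0 <= tx_cost M u.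
Proof.
have [[_ _ _ [[U0 _ Ub] _]] [_ [[c0 ch] _]]] := hM => Uu.
by rewrite -c0; apply: ch => //; have /andP[] := Ub _ Uu.
Qed.

Let b0' : (0 <= b%:E)%E. Proof. by rewrite lee_fin ltW. Qed.

Let b1' : 0 <= 1 - b. Proof. by rewrite subr_ge0 ltW. Qed.

Lemma drop_cost_ge0 g e s : (forall e s, 0 <= g e s) ->
  (0 <= drop_cost b g e s)%E.
Proof.
move=> g0; apply: adde_ge0; first by rewrite lee_fin mulr_ge0.
by rewrite mule_ge0 // expect_ge0.
Qed.

Lemma recv_cost_ge0 g s : (forall e s, 0 <= g e s) ->
  (0 <= recv_cost b g s)%E.
Proof. by move=> g0; rewrite mule_ge0 // expect_ge0. Qed.

Lemma bellman_rhsE g e s u : (forall e s, 0 <= g e s) -> powers M u ->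
  bellman_rhs b g e s u = (((1 - b) * tx_cost M u)%:E +
    \sum_s' (chan M s s')%:E * step_cost b g u e s')%E.
Proof.
move=> g0 Uu; rewrite /bellman_rhs /transition mulrDr EFinD -addeA.
congr (_ + _)%E; rewrite mulr_sumr -sumEFin.
have p0 s' : (0 <= (drop_prob M s' u)%:E)%E by rewrite lee_fin prob0.
have q0 s' : (0 <= (1 - drop_prob M s' u)%:E)%E.
  by rewrite lee_fin subr_ge0 prob1.
have A0 x s' : (0 <= expect (noise M) (fun w => (g (x + w)%R s')%:E))%E.
  by rewrite expect_ge0.
have B0 s' : (0 <= expect (noise M) (fun w => (g w s')%:E))%E.
  by rewrite expect_ge0.
have st0 s' : (0 <= packet_step u (fun e' s' => (g e' s')%:E) e s')%E.
  by rewrite /packet_step adde_ge0 // mule_ge0.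
rewrite ge0_sume_distrr; last first.
  by move=> s' _; rewrite mule_ge0 // lee_fin.
rewrite -big_split; apply: eq_bigr => s' _ /=.
rewrite /step_cost /drop_cost /recv_cost /packet_step.
have d0 : (0 <= ((1 - b) * distortion M e)%:E)%E by rewrite lee_fin mulr_ge0.
rewrite [X in _ = (_ * (X + _))%E]ge0_muleDr ?mule_ge0 //.
rewrite -addeA [RHS]ge0_muleDr ?adde_ge0 ?mule_ge0 //.
congr (_ + _)%E; first by rewrite -!EFinM; congr (_%:E); ring.
rewrite muleCA ge0_muleDr ?mule_ge0 //.
by congr (_ * (_ + _))%E; rewrite muleCA.
Qed.

Lemma step_cost_ge0 g u e s : (forall e s, 0 <= g e s) -> powers M u ->
  (0 <= step_cost b g u e s)%E.
Proof.
move=> g0 Uu; rewrite adde_ge0 // mule_ge0 ?lee_fin ?subr_ge0 ?prob0 ?prob1 //.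
- exact: drop_cost_ge0.
- exact: recv_cost_ge0.
Qed.

Lemma bellman_rhs_ge0 g e s u : (forall e s, 0 <= g e s) -> powers M u ->
  (0 <= bellman_rhs b g e s u)%E.
Proof.
move=> g0 Uu; rewrite bellman_rhsE // adde_ge0 ?lee_fin ?mulr_ge0 ?cost0 //.
by apply: sume_ge0 => s' _; rewrite mule_ge0 ?lee_fin ?step_cost_ge0.
Qed.

Lemma le_bellman_rhs g h e s u :
  (forall s, measurable_src (g^~ s)) -> (forall s, measurable_src (h^~ s)) ->
  (forall e s, 0 <= g e s) -> (forall e s, g e s <= h e s) -> powers M u ->
  (bellman_rhs b g e s u <= bellman_rhs b h e s u)%E.
Proof.
move=> mg mh g0 gh Uu.
have h0 e' s' : 0 <= h e' s' by exact: le_trans (gh _ _).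
rewrite !bellman_rhsE // leeD2l // lee_sum // => s' _.
rewrite lee_wpmul2l ?lee_fin // leeD //; last first.
  rewrite lee_wpmul2l ?lee_fin ?subr_ge0 ?prob1 //.
  by rewrite lee_wpmul2l // le_expect.
rewrite lee_wpmul2l ?lee_fin ?prob0 // leeD2l // lee_wpmul2l //.
apply: le_expect => //.
- exact: (measurable_src_translate (f := g^~ s')).
- exact: (measurable_src_translate (f := h^~ s')).
Qed.

Lemma drop_cost_norm_homo g s : (forall e s, 0 <= g e s) ->
  norm_homo (g^~ s) -> norm_homo (fun e => drop_cost b g e s).
Proof.
move=> g0 gh x y xy; apply: leeD.
  by rewrite lee_fin ler_wpM2l // dist_norm_homo.
rewrite lee_wpmul2l //.
apply: (expect_norm_homo mmu mu0 muh (g := g^~ s)) => //.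
by rewrite !normrM ler_wpM2l.
Qed.

(** A reception acts like a drop at error 0, where the averaged continuation is least, and it incurs
    no distortion. *)
Lemma recv_le_drop_cost g e s : (forall e s, 0 <= g e s) ->
  norm_homo (g^~ s) -> (recv_cost b g s <= drop_cost b g e s)%E.
Proof.
move=> g0 gh; rewrite -[leLHS]add0e leeD ?lee_fin ?mulr_ge0 // lee_wpmul2l //.
have := expect_norm_homo mmu mu0 muh (g := g^~ s) (fun _ => g0 _ _) gh.
move=> /(_ 0 (ar_coef M * e)); rewrite normr0 normr_ge0 => /(_ isT).
by under [X in expect _ X]funext do rewrite add0r.
Qed.

Lemma bellman_rhs_norm_homo g s u : (forall e s, 0 <= g e s) ->
  (forall s, norm_homo (g^~ s)) -> powers M u ->
  norm_homo (fun e => bellman_rhs b g e s u).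
Proof.
move=> g0 gh Uu x y xy; rewrite !bellman_rhsE // leeD2l // lee_sum // => s' _.
rewrite lee_wpmul2l ?lee_fin // leeD2r // lee_wpmul2l ?lee_fin ?prob0 //.
exact: drop_cost_norm_homo.
Qed.

Lemma step_cost_antitone g u e s s' : (forall e s, 0 <= g e s) ->
  (forall s, norm_homo (g^~ s)) ->
  (forall e s s', (s <= s')%N -> g e s' <= g e s) -> powers M u ->
  (s <= s')%N -> (step_cost b g u e s' <= step_cost b g u e s)%E.
Proof.
move=> g0 gh gs Uu ss'.
have mg k : measurable_src (g^~ k) by exact: measurable_src_norm_homo.
(* Intermediate mixture: drop probability of the better state [s'], costs of the worse state [s].
   First the costs change, then the weights, the latter because reception is cheaper than a drop. *)
apply: (@le_trans _ _ ((drop_prob M s' u)%:E * drop_cost b g e s +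
                       (1 - drop_prob M s' u)%:E * recv_cost b g s)%E).
  apply: leeD; apply: lee_wpmul2l; rewrite ?lee_fin ?subr_ge0 ?prob0 ?prob1 //.
    rewrite leeD2l // lee_wpmul2l //; apply: le_expect => //.
    - exact: (measurable_src_translate (f := g^~ s')).
    - exact: (measurable_src_translate (f := g^~ s)).
    - by move=> w; exact: gs.
  by rewrite lee_wpmul2l //; apply: le_expect => // w; exact: gs.
apply: le_mix; rewrite ?prob0 ?prob1 ?prob_s ?recv_cost_ge0 //.
exact: recv_le_drop_cost.
Qed.

Lemma bellman_rhs_antitone g u e s s' : stochastically_monotone (chan M) ->
  (forall e s, 0 <= g e s) -> (forall s, norm_homo (g^~ s)) ->
  (forall e s s', (s <= s')%N -> g e s' <= g e s) -> powers M u ->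
  (s <= s')%N -> (bellman_rhs b g e s' u <= bellman_rhs b g e s u)%E.
Proof.
move=> Qm g0 gh gs Uu ss'; rewrite !bellman_rhsE // leeD2l //.
apply: stochastically_monotone_le => //.
- by move=> k; exact: step_cost_ge0.
- by move=> k l kl; exact: step_cost_antitone.
Qed.

(** Both sides carry the same transmission costs, and the smaller power [v] has the larger drop
    probability, so [mix_submodular] applies at every next state. *)
Lemma bellman_rhs_submodular g s x y u v : (forall e s, 0 <= g e s) ->
  (forall s, norm_homo (g^~ s)) -> powers M u -> powers M v ->
  `|x| <= `|y| -> v <= u ->
  (bellman_rhs b g x s v + bellman_rhs b g y s u <=
   bellman_rhs b g x s u + bellman_rhs b g y s v)%E.
Proof.
move=> g0 gh Uu Uv xy vu; rewrite !bellman_rhsE //.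
rewrite addeACA [leRHS]addeACA [X in (_ <= X + _)%E]addeC leeD2l //.
rewrite -!big_split lee_sum // => s' _ /=.
rewrite -!ge0_muleDr ?step_cost_ge0 // lee_wpmul2l ?lee_fin //.
apply: mix_submodular;
  rewrite ?prob0 ?prob1 ?prob_u ?recv_cost_ge0 ?drop_cost_ge0 //.
exact: drop_cost_norm_homo.
Qed.

End bellman_operator.

(** * Monotonicity of the value function *)

(** One notion for monotonicity in [|e|] at a fixed state and for joint monotonicity in [|e|] and
    the reversed state order; it passes to pointwise suprema. *)
Definition mono_along (X S : Type) (disp : Order.disp_t)
    (Y : porderType disp) (r : X -> S -> X -> S -> Prop) (g : X -> S -> Y) :=
  forall e s e' s', r e s e' s' -> (g e s <= g e' s')%O.

(* Value iteration may fail to converge to J (no continuity of the costs in u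
   is assumed), so J is reached from below as the supremum of all r-monotone
   subsolutions below it, as in the Knaster-Tarski theorem. *)
Lemma value_function_mono (R : realType) (t : alphabet) (M : model R t) (b : R)
    (r : carrier R t -> 'I_(nstates M) -> carrier R t -> 'I_(nstates M) -> Prop)
    (J : carrier R t -> 'I_(nstates M) -> R) :
  standing_assumptions M -> 0 < b -> b < 1 ->
  (forall e e' s, `|e| <= `|e'| -> r e s e' s) ->
  (forall g : carrier R t -> 'I_(nstates M) -> R, (forall e s, 0 <= g e s) ->
    mono_along r g -> forall u, powers M u ->
    mono_along r (fun e s => bellman_rhs b g e s u)) ->
  is_value_function b J -> mono_along r J.
Proof.
move=> hM b0 b1 re rB [[J0 mJ JE] Jmin].
(* Since [r] contains the order by [|e|], monotonicity supplies measurability, even for a supremum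
   over an uncountable family. *)
have mr g : mono_along r g -> forall s, @measurable_src R t (g^~ s).
  by move=> gr s; apply: measurable_src_norm_homo => x y xy; exact/gr/re.
pose I (g : carrier R t -> 'I_(nstates M) -> R) e s :=
  ereal_inf (bellman_rhs b g e s @` powers M).
have I0 (g : carrier R t -> 'I_(nstates M) -> R) e s :
    (forall e s, 0 <= g e s) -> (0 <= I g e s)%E.
  move=> g0; apply/ereal_infP => _ [u Uu <-].
  exact: bellman_rhs_ge0.
have leI (g h : carrier R t -> 'I_(nstates M) -> R) :
    (forall s, measurable_src (g^~ s)) ->
    (forall s, measurable_src (h^~ s)) -> (forall e s, 0 <= g e s) ->
    (forall e s, g e s <= h e s) -> forall e s, (I g e s <= I h e s)%E.
  move=> mg mh g0 gh e s; apply/ereal_infP => _ [u Uu <-].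
  apply: le_trans (le_bellman_rhs hM b0 b1 e s mg mh g0 gh Uu).
  by apply: ereal_inf_lbound; exists u.
pose A := [set g : carrier R t -> 'I_(nstates M) -> R |
  [/\ forall e s, 0 <= g e s, forall e s, g e s <= J e s, mono_along r g &
      forall e s, ((g e s)%:E <= I g e s)%E]].
pose G e s := sup [set g e s | g in A].
have A0 : A (fun _ _ => 0) by split=> // e s; exact: I0.
have leG g e s : A g -> g e s <= G e s.
  move=> Ag; apply: ub_le_sup; last by exists g.
  by exists (J e s) => _ [h [_ hJ _ _] <-].
have Gle e s x : (forall g, A g -> g e s <= x) -> G e s <= x.
  move=> gx; apply: ge_sup; first by exists 0; exists (fun _ _ => 0).
  by move=> _ [g Ag <-]; exact: gx.
have G0 e s : 0 <= G e s by exact: (leG (fun _ _ => 0)).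
have GJ e s : G e s <= J e s by apply: Gle => g [].
have Gr : mono_along r G.
  move=> e s e' s' res; apply: Gle => g Ag.
  by apply: le_trans (leG _ _ _ Ag); have [_ _ gr _] := Ag; exact: gr.
have IGJ e s : (I G e s <= (J e s)%:E)%E.
  by rewrite JE; apply: leI => //; exact: mr.
(* [I G] lies between 0 and [J], so it is finite and [fine] loses nothing. *)
pose H e s := fine (I G e s).
have HE e s : (H e s)%:E = I G e s.
  by rewrite fineK // ge0_fin_numE ?I0 // (le_lt_trans (IGJ e s)) ?ltry.
have GH e s : G e s <= H e s.
  apply: Gle => g Ag; have [g0 _ gr gI] := Ag.
  rewrite -lee_fin HE; apply: le_trans (gI e s) _; apply: leI => //.
  - exact: mr.
  - exact: mr.
  - by move=> e' s'; exact: leG.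
have Hr : mono_along r H.
  move=> e s e' s' res; rewrite -lee_fin !HE; apply/ereal_infP => _ [u Uu <-].
  apply: le_trans (rB G G0 Gr u Uu _ _ _ _ res).
  by apply: ereal_inf_lbound; exists u.
(* Membership of [H] in the family gives [H <= G]; with [GH], the supremum [G] is a fixed point. *)
have AH : A H.
  split=> //.
  - by move=> e s; exact: le_trans (GH e s).
  - by move=> e s; rewrite -lee_fin HE.
  - by move=> e s; rewrite HE; apply: leI => //; exact: mr.
have JG : J = G.
  apply/funext => e; apply/funext => s; apply/le_anti; rewrite GJ andbT.
  apply: Jmin; split=> //; first exact: mr.
  by move=> e' s'; rewrite -/(I G e' s') -HE; congr (_%:E); apply/le_anti;
    rewrite GH leG.
by rewrite JG.
Qed.

Lemma value_function_norm_homo (R : realType) (t : alphabet) (M : model R t)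
    (b : R) (J : carrier R t -> 'I_(nstates M) -> R) :
  standing_assumptions M -> 0 < b -> b < 1 -> is_value_function b J ->
  forall s, norm_homo (J^~ s).
Proof.
move=> hM b0 b1 hJ s x y xy.
apply: (@value_function_mono R t M b
  (fun e s e' s' => `|e| <= `|e'| /\ s = s')) => //.
move=> g g0 gr u Uu e k e' _ [ee <-].
by apply: bellman_rhs_norm_homo => // k' x' y' xy'; exact: gr.
Qed.

(** Antitonicity in the state is not propagated alone: it relies on reception being cheaper than a
    drop, hence on monotonicity in [|e|]. The relation therefore carries both. *)
Lemma value_function_antitone (R : realType) (t : alphabet) (M : model R t)
    (b : R) (J : carrier R t -> 'I_(nstates M) -> R) :
  standing_assumptions M -> 0 < b -> b < 1 ->
  stochastically_monotone (chan M) -> is_value_function b J ->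
  forall e (s s' : 'I_(nstates M)), (s <= s')%N -> J e s' <= J e s.
Proof.
move=> hM b0 b1 Qm hJ e s s' ss'.
apply: (@value_function_mono R t M b
  (fun e s e' s' => `|e| <= `|e'| /\ (s' <= s)%N)) => //.
move=> g g0 gr u Uu x k y l [xy lk].
have gh k' : norm_homo (g^~ k') by move=> x' y' xy'; exact: gr.
apply: le_trans (bellman_rhs_norm_homo hM b0 b1 l g0 gh Uu xy).
by apply: bellman_rhs_antitone => // x' k' l' kl'; exact: gr.
Qed.

(** * Monotonicity of the transmission strategy *)

(** Topkis' exchange argument: if [v < u], decreasing differences force [v] to be optimal at [x] too
    and [u] at [y] too. The first contradicts least selection at [x], the second greatest selection
    at [y]. *)
Lemma argmin_strategy_norm_homo (R : realType) (t : alphabet) (M : model R t)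
    (b : R) (J f : carrier R t -> 'I_(nstates M) -> R) :
  standing_assumptions M -> 0 < b -> b < 1 -> is_value_function b J ->
  is_argmin_strategy b J f -> forall s, norm_homo (f^~ s).
Proof.
move=> hM b0 b1 hJ [fmin ftie] s x y xy /=.
have Jh := value_function_norm_homo hM b0 b1 hJ.
have [[J0 _ JE] _] := hJ.
have [Uu ux] := fmin x s; have [Uv vy] := fmin y s.
set u := f x s in Uu ux *; set v := f y s in Uv vy *.
rewrite leNgt; apply/negP => vu.
have sub := bellman_rhs_submodular hM b0 b1 s J0 Jh Uu Uv xy (ltW vu).
(* Optimal values equal the real number [J e s]; this finiteness permits the cancellations below. *)
have minE e w : powers M w ->
    (forall z, powers M z ->
      (bellman_rhs b J e s w <= bellman_rhs b J e s z)%E) ->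
    bellman_rhs b J e s w = (J e s)%:E.
  move=> Uw wmin; rewrite JE; apply/le_anti/andP; split.
    by apply/ereal_infP => _ [z Uz <-]; exact: wmin.
  by apply: ereal_inf_lbound; exists w.
have xv : (bellman_rhs b J x s v <= bellman_rhs b J x s u)%E.
  rewrite -(@leeD2rE _ (bellman_rhs b J y s v)); last by rewrite (minE y).
  by apply: le_trans sub; rewrite leeD2l // vy.
have yu : (bellman_rhs b J y s u <= bellman_rhs b J y s v)%E.
  rewrite -(@leeD2lE _ (bellman_rhs b J x s u)); last by rewrite (minE x).
  by apply: le_trans sub; rewrite leeD2r // ux.
have [flb|fub] := ftie.
- have : u <= v.
    by apply: (flb x s); split=> // w Uw; exact: le_trans xv (ux w Uw).
  by rewrite leNgt vu.
- have : u <= v.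
    by apply: (fub y s); split=> // w Uw; exact: le_trans yu (vy w Uw).
  by rewrite leNgt vu.
Qed.

(** A strict violation at two points is an open condition for pointwise convergence, so it would
    already occur for some [f b] with [0 < b < 1]. The midpoint [m] separates the two values. *)
Lemma limit_point_norm_homo (R : realType) (t : alphabet) (n : nat)
    (f : R -> carrier R t -> 'I_n -> R) (f1 : carrier R t -> 'I_n -> R) :
  (forall b, 0 < b < 1 -> forall s, norm_homo ((f b)^~ s)) ->
  is_limit_point f f1 -> forall s, norm_homo (f1^~ s).
Proof.
move=> fh f1lim s x y xy /=.
have evc (e : carrier R t) : continuous
    (fun g : {ptws carrier R t -> {ptws 'I_n -> R}} => g e s).
  have h1 := @proj_continuous (carrier R t) (fun=> {ptws 'I_n -> R}) e.
  have h2 := @proj_continuous 'I_n (fun=> R) s.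
  by move=> g A nA; exact: (h1 g _ (h2 (g e) A nA)).
rewrite leNgt; apply/negP => yx.
pose m := (f1 y s + f1 x s) / 2.
have hf : ((f : R -> {ptws carrier R t -> {ptws 'I_n -> R}}) @ 1^'-)
    [set f b | b in [set b : R | 0 < b < 1]].
  have : \forall b \near (1 : R)^'-, 0 < b < 1.
    near=> b; apply/andP; split; near: b.
      exact: nbhs_left_gt.
    exact: nbhs_left_lt.
  by apply: filterS => b b01; exists b.
have nx : nbhs (f1 : {ptws carrier R t -> {ptws 'I_n -> R}})
    [set g | m < g x s].
  apply: (evc x f1 _ (open_nbhs_nbhs (conj (@open_gt R m) _))).
  by rewrite /= /m; lra.
have ny : nbhs (f1 : {ptws carrier R t -> {ptws 'I_n -> R}})
    [set g | g y s < m].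
  apply: (evc y f1 _ (open_nbhs_nbhs (conj (@open_lt R m) _))).
  by rewrite /= /m; lra.
have [g [[b b01 fb] gxy]] :=
  f1lim _ _ hf (@filterI _ _ (nbhs_filter _) _ _ nx ny).
have [gx gy] : m < g x s /\ g y s < m by [].
rewrite -fb in gx gy.
by have := fh b b01 s x y xy; rewrite leNgt (lt_trans gy gx).
Unshelve. all: by end_near. Qed.

Theorem corollary2 (R : realType) (t : alphabet) (M : model R t)
    (hM : standing_assumptions M) :
  (forall b : R, 0 < b < 1 -> bounded_discounted_distortion M b ->
    forall J : carrier R t -> 'I_(nstates M) -> R, is_value_function b J ->
      (forall s, even_fun (fun e => J e s) /\ quasi_convex (fun e => J e s)) /\
      (stochastically_monotone (chan M) ->
        (forall e (s s' : 'I_(nstates M)), (s <= s')%N -> J e s' <= J e s) /\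
        (forall f : carrier R t -> 'I_(nstates M) -> R,
          is_argmin_strategy b J f ->
          forall s, even_fun (fun e => f e s) /\
                    quasi_convex (fun e => f e s)))) /\
  (bounded_average_distortion M -> stochastically_monotone (chan M) ->
    forall J f : R -> carrier R t -> 'I_(nstates M) -> R,
      (forall b : R, 0 < b < 1 ->
        is_value_function b (J b) /\ is_argmin_strategy b (J b) (f b)) ->
      forall f1 : carrier R t -> 'I_(nstates M) -> R, is_limit_point f f1 ->
      forall s, even_fun (fun e => f1 e s) /\ quasi_convex (fun e => f1 e s)).
Proof.
split=> [b /andP[b0 b1] _ J hJ|_ _ J f hf f1 hf1 s].
  split=> [s|Qm].
    exact/norm_homoP/(value_function_norm_homo hM b0 b1 hJ).
  split=> [|f hf s]; first exact: (value_function_antitone hM b0 b1 Qm hJ).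
  exact/norm_homoP/(argmin_strategy_norm_homo hM b0 b1 hJ hf).
apply/norm_homoP/(limit_point_norm_homo _ hf1) => b b01 k.
have [hJ hfb] := hf b b01; case/andP: b01 => b0 b1.
exact: (argmin_strategy_norm_homo hM b0 b1 hJ hfb).
Qed.
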